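(* Every $W\sqrt{J}U$ ring $R$ is Dedekind-finite, that is, for all $a,b\in R$, $ab=1$ implies $ba=1$.
   Context: Rings are associative with identity, not necessarily commutative. For a ring $A$, $U(A)$ is its group of units, $J(A)$ its Jacobson radical, and $\sqrt{J(A)}=\{x\in A : x^n\in J(A)\text{ for some } n\ge 1\}$. A ring $A$ is $W\sqrt{J}U$ (weakly $\sqrt{J}U$) if $U(A)=\pm 1+\sqrt{J(A)}$; equivalently, every unit of $A$ can be written as $j+1$ or as $j-1$ for some $j\in\sqrt{J(A)}$. *)

(* Defs.v *)
From mathcomp Require Import all_boot all_algebra all_classical.

Set Implicit Arguments.
Unset Strict Implicit.
Unset Printing Implicit Defensive.

Import GRing.Theory.
Local Open Scope classical_set_scope.
Local Open Scope ring_scope.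

(* Rings are taken in [pzRingType], so that the zero ring is included; since
   [GRing.unit] is only available on rings with a computable inverse, the group
   of units is defined directly. *)
Definition units (R : pzRingType) : set R :=
  [set u | exists v : R, u * v = 1 /\ v * u = 1].

Definition left_ideal (R : pzRingType) (I : set R) : Prop :=
  [/\ I 0,
      (forall x y : R, I x -> I y -> I (x - y)) &
      (forall a x : R, I x -> I (a * x))].

Definition maximal_left_ideal (R : pzRingType) (M : set R) : Prop :=
  [/\ left_ideal M,
      M <> setT &
      forall I : set R, left_ideal I -> M `<=` I -> I = M \/ I = setT].

(* In the zero ring the intersection is over an empty family: J(0) = 0. *)
Definition jacobson (R : pzRingType) : set R :=
  \bigcap_(M in [set M : set R | maximal_left_ideal M]) M.

Definition sqrt_jacobson (R : pzRingType) : set R :=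
  [set x : R | exists2 n : nat, (1 <= n)%N & jacobson (x ^+ n)].

Definition weakly_sqrtJU (R : pzRingType) : Prop :=
  @units R =
    [set 1 + j | j in @sqrt_jacobson R] `|` [set -1 + j | j in @sqrt_jacobson R].

Definition Dedekind_finite (R : pzRingType) : Prop :=
  forall a b : R, a * b = 1 -> b * a = 1.

(* Main.v *)
Require Import Defs.
From mathcomp Require Import all_boot all_algebra all_classical.

(** Suppose [a * b = 1] and put [e = 1 - b * a].  Then [p = e * a] and
    [q = b * e] are the off-diagonal units of a system of 2 x 2 matrix units,
    with [p * q = e].  It is therefore enough that such a system must be trivial
    in the rings considered ([matrix_units2_eq0]).

    Let [f = p * q + q * p] be the identity of the matrix corner.  The Fibonacci
    matrix [A] with rows (1, 1) and (1, 0) satisfies [A ^ 2 = A + 1], so that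
    [A], [A - 1] and [A + 1] are all invertible: [A - 1] is the inverse of [A],
    and [A + 1] is its square.  The element [u] equal to [A] on the corner and
    to 1 on the complement [1 - f] is then a unit for which both [u - 1] and
    [u + 1] are invertible on the corner.  One of these two elements has a power
    in the Jacobson radical; as the radical is a left ideal, it contains [f]
    ([jacobson_corner]).  But an idempotent of the radical is zero
    ([jacobson_idempotent]).

    The matrices enter only through [d = u - 1], the inverse of [A] in the
    corner, which satisfies [d * d + d = f] and [f * d = d], that is
    [d ^ 3 = d - d ^ 2]; the argument is carried out for all such elements in
    [golden_element_eq0]. *)

Set Implicit Arguments.
Unset Strict Implicit.
Unset Printing Implicit Defensive.

Import GRing.Theory.
Local Open Scope classical_set_scope.
Local Open Scope ring_scope.

Lemma left_idealD (R : pzRingType) (I : set R) (x y : R) :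
  left_ideal I -> I x -> I y -> I (x + y).
Proof.
move=> [I0 IB _] Ix Iy; rewrite -[y]opprK; apply: (IB _ _ Ix).
by rewrite -sub0r; apply: IB.
Qed.

Lemma left_ideal_full (R : pzRingType) (I : set R) :
  left_ideal I -> I 1 -> I = setT.
Proof.
by move=> [_ _ IM] I1; apply/seteqP; split=> // x _; rewrite -[x]mulr1; apply: IM.
Qed.

Lemma left_ideal_principal (R : pzRingType) (z : R) :
  left_ideal [set x : R | exists r, x = r * z].
Proof.
split; first by exists 0; rewrite mul0r.
- by move=> _ _ [r ->] [s ->]; exists (r - s); rewrite mulrBl.
- by move=> x _ [r ->]; exists (x * r); rewrite mulrA.
Qed.

Lemma left_ideal_jacobson (R : pzRingType) : left_ideal (@jacobson R).
Proof.
split=> [M [[]] //|x y Jx Jy M maxM|r x Jx M maxM]; have [[_ MB MM] _ _] := maxM.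
- by apply: MB; [apply: Jx|apply: Jy].
- by apply: MM; apply: Jx.
Qed.

(** Krull's theorem.  Zorn's lemma is applied to the sets [X] such that
    [I `|` X] is a proper left ideal, rather than to the left ideals
    containing [I], because the union of the empty chain is [set0]. *)
Lemma maximal_left_ideal_exists (R : pzRingType) (I : set R) :
  left_ideal I -> ~ I 1 -> exists2 M, maximal_left_ideal M & I `<=` M.
Proof.
move=> idI I1.
pose P (X : set R) := left_ideal (I `|` X) /\ ~ (I `|` X) 1.
have [F FP totF|A [[idA A1] maxA]] := @Zorn_bigcup R P.
  have [I0 IB IM] := idI; split; last first.
    by case=> [//|[X FX X1]]; have [_] := FP _ FX; apply; right.
  split; first by left.
  - have sub X x y : F X -> (I `|` X) x -> (I `|` X) y ->
        (I `|` \bigcup_(Y in F) Y) (x - y).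
      move=> FX Xx Xy; have [[_ XB _] _] := FP _ FX.
      by case: (XB _ _ Xx Xy) => [|Xxy]; [left|right; exists X].
    move=> x y [Ix|[X FX Xx]] [Iy|[Y FY Yy]].
    + by left; apply: IB.
    + by apply: (sub Y) => //; [left|right].
    + by apply: (sub X) => //; [right|left].
    + case: (totF X Y FX FY) => XY.
        by apply: (sub Y) => //; right=> //; apply: XY.
      by apply: (sub X) => //; right=> //; apply: XY.
  - move=> r x [Ix|[X FX Xx]]; first by left; apply: IM.
    have [[_ _ XM] _] := FP _ FX.
    by case: (XM r x); [right|left|right; exists X].
exists (I `|` A); last by move=> x; left.
split=> [//|AT|L idL AL]; first by apply: A1; rewrite AT.
have [L1|L1] := pselect (L 1); first by right; apply: left_ideal_full.
left; have IL : I `|` L = L by apply/setUidPr => x Ix; apply: AL; left.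
have [LA|LA] := pselect (L `<=` A).
  by apply/seteqP; split=> // x Lx; right; apply: LA.
case: (maxA L); last by rewrite /P IL.
by split=> // x Ax; apply: AL; right.
Qed.

(** If [f] is nonzero then [R (1 - f)] is a proper left ideal; a maximal left
    ideal above it contains [1 - f] and also [f], hence 1. *)
Lemma jacobson_idempotent (R : pzRingType) (f : R) :
  f * f = f -> jacobson f -> f = 0.
Proof.
move=> ff Jf; apply: contrapT => f0.
have [[r r1]|M maxM subM] :=
    maximal_left_ideal_exists (left_ideal_principal (1 - f)).
  by apply: f0; rewrite -[f]mul1r r1 -mulrA mulrBl mul1r ff subrr mulr0.
have [idM MT _] := maxM; apply/MT/left_ideal_full => //.
rewrite -(subrK f 1); apply: left_idealD => //; last exact: Jf.
by apply: subM; exists 1; rewrite mul1r.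
Qed.

(** The element [g] is a left inverse of [x] relative to the corner of [f], and
    [g ^+ n * x ^+ n = f] for all positive [n] because [g] absorbs [f]. *)
Lemma jacobson_corner (R : pzRingType) (f g x : R) :
  g * x = f -> g * f = g -> sqrt_jacobson x -> jacobson f.
Proof.
move=> gx gf [[//|n] _ Jx]; have [_ _ JM] := left_ideal_jacobson R.
suff <- : g ^+ n.+1 * x ^+ n.+1 = f by apply: JM.
elim: n {Jx} => [|n IHn]; first by rewrite !expr1.
rewrite (exprSr g n.+1) (exprS x n.+1) mulrA -(mulrA _ g x) gx (exprSr g n).
by rewrite -(mulrA _ g f) gf -exprSr.
Qed.

(** The hypothesis says that [f = d * d + d] satisfies [f * d = d]; hence [f] is
    idempotent and [d] lies in its corner.  There [1 + d] is a unit of [R] with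
    inverse [1 - d * d], and [f] is a left multiple of [(1 + d) - 1 = d] by
    [f + d] as well as of [(1 + d) + 1] by [d * d]. *)
Lemma golden_element_eq0 (R : pzRingType) (d : R) :
  weakly_sqrtJU R -> d * d * d = d - d * d -> d = 0.
Proof.
move=> wR d3; set f := d * d + d.
have fd : f * d = d by rewrite mulrDl d3 subrK.
have df : d * f = d by rewrite mulrDr mulrA d3 subrK.
have ff : f * f = f by rewrite {1}/f mulrDl -mulrA !df.
suff Jf : jacobson f by rewrite -fd (jacobson_idempotent ff Jf) mul0r.
have : units (1 + d).
  exists (1 - d * d); split.
    by rewrite mulrBr mulr1 mulrDl mul1r mulrA d3 [d * d + _]addrC subrK addrK.
  by rewrite mulrDr mulr1 mulrBl mul1r d3 subKr subrK.
rewrite wR => -[] [j Jj].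
  move=> /addrI jd; apply: (@jacobson_corner _ f (f + d) j) => //.
    by rewrite jd mulrDl fd addrC.
  by rewrite mulrDl ff df.
move=> jd; apply: (@jacobson_corner _ f (d * d) j) => //; last by rewrite -mulrA df.
have -> : j = 1 + (1 + d) by rewrite -jd addNKr.
by rewrite !mulrDr mulr1 d3 [d * d + (d - _)]addrC subrK.
Qed.

(** The hypotheses say that [p] and [q] are the off-diagonal units of a system
    of 2 x 2 matrix units.  The element [d] is the matrix with rows (0, 1) and
    (1, -1), the inverse of the Fibonacci matrix. *)
Lemma matrix_units2_eq0 (R : pzRingType) (p q : R) :
    weakly_sqrtJU R ->
    p * p = 0 -> q * q = 0 -> p * q * p = p -> q * p * q = q ->
  p = 0.
Proof.
move=> wR pp qq pqp qpq; pose d := p + q - q * p.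
have pd : p * d = p * q - p by rewrite mulrBr mulrDr pp add0r mulrA pqp.
have qd : q * d = q * p by rewrite mulrBr mulrDr qq addr0 mulrA qq mul0r subr0.
have pqd : p * q * d = p by rewrite -mulrA qd mulrA.
have qpd : q * p * d = q - q * p by rewrite -mulrA pd mulrBr mulrA qpq.
have dd : d * d = p * q + q * p - d.
  rewrite {1}/d mulrBl mulrDl pd qd qpd opprB [_ - p + _]addrAC -[LHS]addrA.
  by congr (_ + _); rewrite /d opprB addrCA -opprD.
have d0 : d = 0.
  apply: golden_element_eq0 => //; rewrite {1}dd mulrBl mulrDl pqd qpd.
  by rewrite addrA.
by rewrite -pqd d0 mulr0.
Qed.

Theorem proposition2p12 (R : pzRingType) :
  weakly_sqrtJU R -> Dedekind_finite R.
Proof.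
move=> wR a b ab.
pose e := 1 - b * a.
have ae : a * e = 0 by rewrite mulrBr mulr1 mulrA ab mul1r subrr.
have eb : e * b = 0 by rewrite mulrBl mul1r -mulrA ab mulr1 subrr.
have ee : e * e = e by rewrite {1}/e mulrBl mul1r -mulrA ae mulr0 subr0.
have pq : (e * a) * (b * e) = e by rewrite mulrA -(mulrA e) ab mulr1 ee.
have p0 : e * a = 0.
  apply: (matrix_units2_eq0 (q := b * e)) => //.
  - by rewrite mulrA -(mulrA e) ae mulr0 mul0r.
  - by rewrite mulrA -(mulrA b) eb mulr0 mul0r.
  - by rewrite pq mulrA ee.
  - by rewrite -mulrA pq -mulrA ee.
have : e = 0 by rewrite -pq p0 mul0r.
by move/eqP; rewrite subr_eq0 => /eqP.
Qed.
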